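(* Let $\alpha,c,N$ be real numbers with $\alpha+c-N\neq -1,-2,\dots$. Let $P_2$ be an arbitrary polynomial of degree $k\ge 1$, written in the form $P_2(x)=\sum_{j=0}^kw_jr_j(x)$ for certain numbers $w_j$, $j=0,\dots,k$, where $r_0=1$ and $r_j(x)=(-1)^j\prod_{i=0}^{j-1}[x+i(\alpha+c-N-2-i)]$ for $j\ge 1$. Let $P_1$ be the polynomial of degree $k+1$ $$P_1(x)=(\alpha+c-N)P_2(x)+2(x-\alpha-c+N+1)\sum_{j=0}^k\frac{w_j}{j+1}r_j(x).$$ Put $\theta_n=(n+1)(n+\alpha+c-N-1)$, $\sigma_n=2n+\alpha+c-N-2$, $u_j(n)=(n)_j(-n-\alpha-c+N+2)_j$, and define $$\gamma_n=\sum_{j=0}^kw_ju_j(n)\ (n\ge 0),$$ $$\beta_{n,1}=\frac{n(N-n)(n+\alpha-N)}{(2n+\alpha+c-N-1)(2n+\alpha+c-N-2)}\frac{\gamma_{n+1}}{\gamma_n}\quad(n\ge 1),$$ $$\beta_{n,2}=\frac{n(n+\alpha-N)(n+\alpha+c-1)}{(2n+\alpha+c-N-1)(2n+\alpha+c-N-2)}\frac{\gamma_{n+1}}{\gamma_n}\quad(n\ge 1),$$ $$\lambda_n=\frac{\sigma_n\gamma_n+P_1(\theta_{n-1})}{2}\ (n\ge 1),\qquad \lambda_0=\frac{P_1(\theta_0)-\sigma_1P_2(\theta_0)}{2},$$ where it is implicitly assumed that $\gamma_n\neq 0$ for $n\ge 1$. For $i=1,2$ define $q_{0,i}=1$ and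 $q_{n,i}=h_n^{\alpha,c,N}+\beta_{n,i}h_{n-1}^{\alpha,c,N}$ for $n\ge 1$, where $(h_n^{\alpha,c,N})_n$ are the Hahn polynomials. Let $D_1,D_2$ be the difference operators of order $2k+2$ and genre $(-k-1,k+1)$ $$D_1=\tfrac12P_1(D_{\alpha,c,N})+\Big(-\tfrac{\alpha+c-N}{2}I+(-x+N-1)\Delta\Big)P_2(D_{\alpha,c,N}),$$ $$D_2=\tfrac12P_1(D_{\alpha,c,N})-\Big(\tfrac{\alpha+c-N}{2}I+(x-\alpha)\nabla\Big)P_2(D_{\alpha,c,N}),$$ where $D_{\alpha,c,N}$ is the second order Hahn difference operator. Then $D_i(q_{n,i})=\lambda_nq_{n,i}$ for all $n\ge 0$, $i=1,2$.
   Context: For $l\in\mathbb{Z}$ the shift operator $\mathfrak{s}_l$ acts on polynomials by $\mathfrak{s}_l(f)(x)=f(x+l)$; $\Delta f(x)=f(x+1)-f(x)$, $\nabla f(x)=f(x)-f(x-1)$, $I$ is the identity. A finite difference operator $\sum_{l=s}^r f_l\,\mathfrak{s}_l$ (with polynomial coefficients $f_l$) with $f_s,f_r\neq 0$ has order $r-s$ and genre $(s,r)$. For a linear operator $T$ and a polynomial $P(x)=\sum_j a_jx^j$, $P(T)=\sum_j a_jT^j$; products of operators are compositions. $(y)_j=y(y+1)\cdots(y+j-1)$, $(y)_0=1$. Monic Hahn polynomials: $h_n^{\alpha,c,N}(x)=\sum_{j=0}^n\frac{(-n)_j(-x)_j(1-N+j)_{n-j}(c+j)_{n-j}}{(n+\alpha+c-N+j)_{n-j}\,j!}$.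 Hahn operator: $$D_{\alpha,c,N}=x(x-\alpha)\mathfrak{s}_{-1}+[-2x^2+(\alpha-c+N-1)x+\alpha+N(c-1)-1]\mathfrak{s}_0+(x+c)(x-N+1)\mathfrak{s}_1,$$ which satisfies $D_{\alpha,c,N}(h_n^{\alpha,c,N})=\theta_nh_n^{\alpha,c,N}$ with $\theta_n=(n+1)(n+\alpha+c-N-1)$.
   Formalization: The equation D_i(q_{n,i})=λ_n q_{n,i} is asserted for every n≥0 except n=1 when α+c−N=0, where the denominator (2n+α+c−N−1)(2n+α+c−N−2) vanishes and β_{1,i}, hence q_{1,i}, is undefined. *)

(* Defs.v *)
From HB Require Import structures.
From mathcomp Require Import all_boot all_order all_algebra.
From mathcomp Require Import reals.

Set Implicit Arguments.
Unset Strict Implicit.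
Unset Printing Implicit Defensive.
Import Order.TTheory GRing.Theory Num.Theory.
Local Open Scope ring_scope.

(* Also used with y a polynomial, e.g. (-x)_j is poch (- 'X) j. *)
Definition poch (A : comNzRingType) (y : A) (j : nat) : A :=
  \prod_(i < j) (y + i%:R).

Section Operators.
Variable R : realType.
Implicit Types (p P : {poly R}) (T : {poly R} -> {poly R}).

Definition shift (l : int) p : {poly R} := p \Po ('X + (l%:~R)%:P).

Definition Delta p : {poly R} := shift 1 p - p.
Definition Nabla p : {poly R} := p - shift (-1) p.

Definition poly_op P T p : {poly R} := \sum_(j < size P) P`_j *: iter j T p.

(* T = \sum_(s <= l <= r) f_l shift_l with f_s, f_r nonzero; the order of T
   is then r - s.  The integer l is written s + i with 0 <= i <= r - s. *)
Definition has_genre T (s r : int) : Prop :=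
  s <= r /\
  exists f : int -> {poly R},
    [/\ f s != 0, f r != 0 &
        forall p, T p = \sum_(i < `|r - s|%N.+1)
                          f (s + i%:Z) * shift (s + i%:Z) p].

End Operators.

Section Hahn.
Variables (R : realType) (alpha c N : R).
Implicit Types (n j k : nat) (w : nat -> R) (p : {poly R}).

Definition hahn n : {poly R} :=
  \sum_(j < n.+1)
    (poch (- n%:R) j * poch (1 - N + j%:R) (n - j) * poch (c + j%:R) (n - j)
     / (poch (n%:R + alpha + c - N + j%:R) (n - j) * (j`!)%:R))
    *: poch (- 'X) j.

Definition hahn_op p : {poly R} :=
  'X * ('X - alpha%:P) * shift (-1) p
  + (- 2%:R *: 'X^2 + (alpha - c + N - 1) *: 'X
     + (alpha + N * (c - 1) - 1)%:P) * shift 0 p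
  + ('X + c%:P) * ('X - (N - 1)%:P) * shift 1 p.

Definition theta n : R := (n%:R + 1) * (n%:R + alpha + c - N - 1).
Definition sigma n : R := 2%:R * n%:R + alpha + c - N - 2%:R.

Definition r_poly j : {poly R} :=
  (-1) ^+ j *: \prod_(i < j) ('X + (i%:R * (alpha + c - N - 2%:R - i%:R))%:P).

Definition u j n : R := poch n%:R j * poch (- n%:R - alpha - c + N + 2%:R) j.

Definition gamma k w n : R := \sum_(j < k.+1) w j * u j n.

Definition beta_den n : R :=
  (2%:R * n%:R + alpha + c - N - 1) * (2%:R * n%:R + alpha + c - N - 2%:R).

Definition beta1 k w n : R :=
  n%:R * (N - n%:R) * (n%:R + alpha - N) / beta_den n
  * (gamma k w n.+1 / gamma k w n).

Definition beta2 k w n : R :=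
  n%:R * (n%:R + alpha - N) * (n%:R + alpha + c - 1) / beta_den n
  * (gamma k w n.+1 / gamma k w n).

Definition q_poly (beta : nat -> R) n : {poly R} :=
  if n is m.+1 then hahn m.+1 + beta m.+1 *: hahn m else 1.

Definition lambda k w (P1 P2 : {poly R}) n : R :=
  if n is m.+1 then (sigma m.+1 * gamma k w m.+1 + P1.[theta m]) / 2%:R
  else (P1.[theta 0] - sigma 1 * P2.[theta 0]) / 2%:R.

Definition D1 (P1 P2 : {poly R}) p : {poly R} :=
  2%:R^-1 *: poly_op P1 hahn_op p
  + (- ((alpha + c - N) / 2%:R) *: poly_op P2 hahn_op p
     + (- 'X + (N - 1)%:P) * Delta (poly_op P2 hahn_op p)).

Definition D2 (P1 P2 : {poly R}) p : {poly R} :=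
  2%:R^-1 *: poly_op P1 hahn_op p
  - (((alpha + c - N) / 2%:R) *: poly_op P2 hahn_op p
     + ('X - alpha%:P) * Nabla (poly_op P2 hahn_op p)).

End Hahn.

(* Main.v *)
Require Import Defs.
From HB Require Import structures.
From mathcomp Require Import all_boot all_order all_algebra.
From mathcomp Require Import reals ring zify.

Set Implicit Arguments.
Unset Strict Implicit.
Unset Printing Implicit Defensive.
Import Order.TTheory GRing.Theory Num.Theory.
Local Open Scope ring_scope.

(** Put a = alpha + c - N, and let h_n be the Hahn polynomials, so that
    D h_n = theta_n h_n for the Hahn operator D.  Three facts combine.

    - Evaluation at eigenvalues.  theta_{n-1} + i (a - 2 - i) factors as
      (n + i) (n + a - 2 - i); hence r_j (theta_{n-1}) = u_j (n), and
      gamma_n = P2 (theta_{n-1}) ([gamma_theta]).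
    - First-order relations.  With eps_n equal to beta_n without its factor
      gamma_{n+1} / gamma_n, the polynomial h_n + eps_n h_{n-1} satisfies
      (N - 1 - x) Delta (h_n + eps_n h_{n-1})
        = - (n h_n - eps_n (n + a - 1) h_{n-1}),
      and its analogue for (x - alpha) Nabla, with the eps_n of the second
      family, has the opposite right-hand side ([hahn_Delta], [hahn_Nabla]).
      Both are equalities of coefficients in the basis (-x)_j, on which D,
      (N - 1 - x) Delta and x Nabla act by matrices with at most two
      diagonals.
    - A telescoping identity ([P1_step]): P1 is the polynomial for which
      P1 (theta_n) - P1 (theta_{n-1})
        = sigma_{n+1} gamma_{n+1} + sigma_n gamma_n.

    Now let q = h_n + beta_n h_{n-1}.  By the choice of beta_n, applying P2 (D)
    to q gives gamma_{n+1} (h_n + eps_n h_{n-1}), to which the first-order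
    relation applies.  So D_i q is a combination of h_n and h_{n-1}; its
    coefficient on h_{n-1} is lambda_n beta_n, and P1 (theta_n) enters only the
    coefficient on h_n, which is lambda_n by the telescoping identity
    ([pair_eigen]).

    For the genre, D^j is a sum of f_l shift_l over |l| <= j whose two extreme
    coefficients are products of j quadratic polynomials.  The extreme
    coefficients of P1 (D) have degree 2 (k + 1), whereas a coefficient of
    degree at most 1 times a shift of those of P2 (D) has degree at most
    2 k + 1 and cannot cancel them ([first_order_genre]). *)

(** * Shifts and differences as linear maps *)

Section Shifts.
Variable R : realType.
Implicit Types (l m : int) (p q : {poly R}).

Lemma shift_is_linear l : linear (@shift R l).
Proof. exact: (@comp_poly_is_linear R). Qed.

HB.instance Definition _ l :=
  GRing.isLinear.Build R {poly R} {poly R} _ (@shift R l) (shift_is_linear l).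

Lemma shiftM l p q : shift l (p * q) = shift l p * shift l q.
Proof. exact: comp_polyM. Qed.

Lemma shift0 p : shift 0 p = p.
Proof. by rewrite /shift addr0 comp_polyXr. Qed.

Lemma shift_shift l m p : shift l (shift m p) = shift (m + l) p.
Proof.
rewrite /shift -comp_polyA comp_polyD comp_polyX comp_polyC.
by rewrite -addrA -polyCD -intrD [m + l]addrC.
Qed.

Lemma size_shift l p : size (shift l p) = size p.
Proof. by rewrite size_comp_poly2 // size_XaddC. Qed.

Lemma Delta_is_linear : linear (@Delta R).
Proof. by move=> x p q; rewrite /Delta linearP scalerBr; ring. Qed.

HB.instance Definition _ :=
  GRing.isLinear.Build R {poly R} {poly R} _ (@Delta R) Delta_is_linear.

Lemma Nabla_is_linear : linear (@Nabla R).
Proof. by move=> x p q; rewrite /Nabla linearP scalerBr; ring. Qed.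

HB.instance Definition _ :=
  GRing.isLinear.Build R {poly R} {poly R} _ (@Nabla R) Nabla_is_linear.

End Shifts.

(** * Operators as sums of shifts *)

Section DifferenceOperators.
Variable R : realType.
Implicit Types (l : int) (p q P : {poly R}) (f g : int -> {poly R}).
Implicit Types (S T : {poly R} -> {poly R}) (k m n : nat).

Definition diffop m f p : {poly R} :=
  \sum_(i < m.*2.+1) f (i%:Z - m%:Z) * shift (i%:Z - m%:Z) p.

(** The vanishing of [f] outside the window lets windows of different sizes be
    compared, so that sums and compositions of operators can be formed. *)
Definition represents m f T :=
  (forall l, (m < `|l|)%N -> f l = 0) /\ (forall p, T p = diffop m f p).

Lemma represents_widen m n f T :
  (m <= n)%N -> represents m f T -> represents n f T.
Proof.
move/subnKC <-; elim: (n - m)%N => [|d IH] fT; first by rewrite addn0.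
have [f0 Tf] := IH fT; split=> [l lt_l|p]; first by apply: f0; lia.
rewrite Tf {2}/diffop addnS doubleS big_ord_recl big_ord_recr /=.
rewrite f0 ?mul0r ?add0r; last by lia.
rewrite (f0 (_ - _)) ?mul0r ?addr0; last by rewrite /bump; lia.
by apply: eq_bigr => i _; rewrite /bump; congr (f _ * shift _ p); lia.
Qed.

Lemma represents_id : represents 0 (fun l => (l == 0)%:R) id.
Proof.
split=> [l|p]; first by case: eqP => // ->.
by rewrite /diffop big_ord1 /= shift0 mul1r.
Qed.

Lemma representsD m f g S T : represents m f S -> represents m g T ->
  represents m (fun l => f l + g l) (fun p => S p + T p).
Proof.
move=> [f0 Sf] [g0 Tg]; split=> [l lt_l|p]; first by rewrite f0 ?g0 ?addr0.
by rewrite Sf Tg -big_split; apply: eq_bigr => i _; rewrite mulrDl.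
Qed.

Lemma representsM m f T P : represents m f T ->
  represents m (fun l => P * f l) (fun p => P * T p).
Proof.
move=> [f0 Tf]; split=> [l lt_l|p]; first by rewrite f0 ?mulr0.
by rewrite Tf /diffop big_distrr /=; apply: eq_bigr => i _; rewrite mulrA.
Qed.

Lemma represents_shift1 m f T : represents m f T ->
  represents m.+1 (fun l => shift 1 (f (l - 1))) (fun p => shift 1 (T p)).
Proof.
move=> [f0 Tf]; split=> [l lt_l|p]; first by rewrite f0 ?linear0 //; lia.
rewrite Tf /diffop linear_sum doubleS [RHS]big_ord_recl /=.
rewrite [X in shift 1 X * _]f0 ?linear0 ?mul0r ?add0r; last by lia.
rewrite [RHS]big_ord_recl /=.
rewrite [X in shift 1 X * _]f0 ?linear0 ?mul0r ?add0r; last by rewrite /bump; lia.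
apply: eq_bigr => i _; rewrite shiftM shift_shift /bump.
by congr (shift 1 (f _) * shift _ p); lia.
Qed.

Lemma represents_shiftN1 m f T : represents m f T ->
  represents m.+1 (fun l => shift (-1) (f (l + 1))) (fun p => shift (-1) (T p)).
Proof.
move=> [f0 Tf]; split=> [l lt_l|p]; first by rewrite f0 ?linear0 //; lia.
rewrite Tf /diffop linear_sum doubleS [RHS]big_ord_recr /=.
rewrite [X in shift _ X * shift _ p]f0 ?linear0 ?mul0r ?addr0; last by lia.
rewrite [RHS]big_ord_recr /=.
rewrite [X in shift _ X * shift _ p]f0 ?linear0 ?mul0r ?addr0; last by lia.
apply: eq_bigr => i _; rewrite shiftM shift_shift.
by congr (shift (-1) (f _) * shift _ p); lia.
Qed.

Lemma represents_sum m (F : nat -> int -> {poly R})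
    (T : nat -> {poly R} -> {poly R}) n :
  (forall j, (j < n)%N -> represents m (F j) (T j)) ->
  represents m (fun l => \sum_(j < n) F j l) (fun p => \sum_(j < n) T j p).
Proof.
move=> FT; split=> [l lt_l|p].
  by rewrite big1 // => j _; have [-> //] := FT j (ltn_ord j).
under eq_bigr => j _ do have [_ ->] := FT j (ltn_ord j).
by rewrite exchange_big; apply: eq_bigr => i _; rewrite mulr_suml.
Qed.

Lemma represents_genre m f T : represents m f T ->
  f (- m%:Z) != 0 -> f m%:Z != 0 -> has_genre T (- m%:Z) m%:Z.
Proof.
move=> [_ Tf] fl fr; split; first by lia.
exists f; split=> // p.
have -> : `|m%:Z - - m%:Z|%N = m.*2 by lia.
rewrite Tf.
by apply: eq_bigr => i _; congr (f _ * shift _ p); lia.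
Qed.

(** Powers of a second-order operator.  Only one path of length j leads from
    shift 0 to shift j or shift -j, so the extreme coefficients of the j-th
    power are single products and their degrees are known. *)
Section SecondOrder.
Variables A B C : {poly R}.
Hypotheses (size_A : size A = 3%N) (size_C : size C = 3%N).
Variable T : {poly R} -> {poly R}.
Hypothesis TE : forall p, T p = A * shift (-1) p + B * shift 0 p + C * shift 1 p.

Fixpoint iter_coef j l : {poly R} :=
  if j is i.+1 then
    A * shift (-1) (iter_coef i (l + 1)) + B * iter_coef i l
    + C * shift 1 (iter_coef i (l - 1))
  else (l == 0)%:R.

Lemma represents_iter j : represents j (iter_coef j) (iter j T).
Proof.
elim: j => [|j IH]; first exact: represents_id.
have [f0 fE] := @representsD j.+1 _ _ _ _
    (representsD (representsM A (represents_shiftN1 IH))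
      (representsM B (represents_widen (leqnSn j) IH)))
    (representsM C (represents_shift1 IH)).
by split=> //= p; rewrite -fE TE shift0.
Qed.

Lemma size_iter_coef_top j : size (iter_coef j j%:Z) = j.*2.+1.
Proof.
elim: j => [|j IH] /=; first by rewrite size_poly1.
have [f0 _] := represents_iter j.
rewrite (f0 (j.+1%:Z + 1)) ?(f0 j.+1%:Z); try lia.
rewrite linear0 !mulr0 !add0r (_ : j.+1%:Z - 1 = j) ?size_mul; try lia.
- by rewrite size_shift IH size_C; lia.
- by rewrite -size_poly_gt0 size_C.
- by rewrite -size_poly_gt0 size_shift IH.
Qed.

Lemma size_iter_coef_bottom j : size (iter_coef j (- j%:Z)) = j.*2.+1.
Proof.
elim: j => [|j IH] /=; first by rewrite size_poly1.
have [f0 _] := represents_iter j.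
rewrite (f0 (- j.+1%:Z)) ?(f0 (- j.+1%:Z - 1)); try lia.
rewrite linear0 !mulr0 !addr0 (_ : - j.+1%:Z + 1 = - j%:Z) ?size_mul; try lia.
- by rewrite size_shift IH size_A; lia.
- by rewrite -size_poly_gt0 size_A.
- by rewrite -size_poly_gt0 size_shift IH.
Qed.

Definition poly_op_coef P l : {poly R} :=
  \sum_(j < size P) P`_j *: iter_coef j l.

Lemma represents_poly_op P m : (size P <= m.+1)%N ->
  represents m (poly_op_coef P) (poly_op P T).
Proof.
move=> le_P.
apply: (@represents_sum m (fun j l => P`_j *: iter_coef j l)
   (fun j p => P`_j *: iter j T p)) => j lt_j.
have [f0 fE] := representsM (P`_j)%:P
  (represents_widen (leq_trans lt_j le_P : j <= m)%N (represents_iter j)).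
split=> [l /f0|p]; first by rewrite mul_polyC.
rewrite -mul_polyC fE.
by apply: eq_bigr => i _; rewrite mul_polyC.
Qed.

Lemma poly_op_coef_extreme P m l : size P = m.+1 -> `|l|%N = m ->
  poly_op_coef P l = lead_coef P *: iter_coef m l.
Proof.
move=> sP lm; rewrite /poly_op_coef lead_coefE sP big_ord_recr /=.
rewrite big1 ?add0r // => j _.
have [f0 _] := represents_iter j.
by rewrite f0 ?scaler0 // lm.
Qed.

Lemma size_poly_op_coef P m l : size P = m.+1 -> l = m%:Z \/ l = - m%:Z ->
  size (poly_op_coef P l) = m.*2.+1.
Proof.
move=> sP lm; rewrite (poly_op_coef_extreme sP); last by case: lm => ->; lia.
rewrite size_scale ?lead_coef_eq0 -?size_poly_gt0 ?sP //.
by case: lm => ->; rewrite ?size_iter_coef_top ?size_iter_coef_bottom.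
Qed.

End SecondOrder.
End DifferenceOperators.

(** * Pochhammer symbols *)

Section Pochhammer.
Variable A : comNzRingType.
Implicit Types (y : A) (j n : nat).

Lemma poch0 y : poch y 0 = 1.
Proof. exact: big_ord0. Qed.

Lemma pochS y j : poch y j.+1 = poch y j * (y + j%:R).
Proof. exact: big_ord_recr. Qed.

Lemma pochSl y j : poch y j.+1 = y * poch (y + 1) j.
Proof.
rewrite /poch big_ord_recl addr0; congr (_ * _).
by apply: eq_bigr => i _; rewrite lift0 -natr1; ring.
Qed.

Lemma poch_oppn n j : (n < j)%N -> poch (- n%:R : A) j = 0.
Proof. by move=> lt_nj; rewrite /poch (bigD1 (Ordinal lt_nj)) //= addNr mul0r. Qed.

End Pochhammer.

(** * The basis (-x)_j *)

Section FallingBasis.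
Variable R : realType.
Implicit Types (j n : nat) (p q : {poly R}) (b : nat -> R).

Definition fbasis j : {poly R} := poch (- 'X) j.

Lemma mulX_fbasis j : 'X * fbasis j = j%:R *: fbasis j - fbasis j.+1.
Proof. rewrite /fbasis pochS -mul_polyC polyC_natr; ring. Qed.

Lemma shift_fbasis (l : int) j : shift l (fbasis j) = poch (- 'X - (l%:~R)%:P) j.
Proof.
rewrite /fbasis /poch /shift rmorph_prod; apply: eq_bigr => i _ /=.
by rewrite rmorphD rmorphN /= comp_polyX rmorph_nat opprD.
Qed.

Lemma Delta_fbasis j : Delta (fbasis j) = - (j%:R *: fbasis j.-1).
Proof.
rewrite /Delta shift_fbasis /fbasis; case: j => [|j].
  by rewrite !poch0 scale0r subrr oppr0.
rewrite pochSl (pochS (- 'X)) polyC1 subrK -mul_polyC polyC_natr /= -natr1.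
by ring.
Qed.

(** The backward shift (-x+1)_j is not a short combination of the basis, but
    (-x) (-x+1)_j = (-x)_{j+1}: multiplication by x brings it back. *)
Lemma mulX_Nabla_fbasis j : 'X * Nabla (fbasis j) = j%:R *: fbasis j.
Proof.
rewrite -mul_polyC polyC_natr /Nabla shift_fbasis mulrNz polyCN polyC1 opprK.
rewrite /fbasis.
have E : - 'X * poch (- 'X + 1) j = poch (- 'X) j * (- 'X + j%:R) :> {poly R}.
  by rewrite -pochSl pochS.
by rewrite mulrBr -[X in _ - X]opprK -mulNr E; ring.
Qed.

(** The subdiagonal term of index j moves to index j - 1; the hypothesis
    [b n.+1 = 0] makes the sum on the right fill its range. *)
Lemma lowering_fbasis (T : {poly R} -> {poly R}) (s t : nat -> R) n b :
  linear T ->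
  (forall j, T (fbasis j) = s j *: fbasis j + (j%:R * t j) *: fbasis j.-1) ->
  b n.+1 = 0 ->
  T (\sum_(j < n.+1) b j *: fbasis j) =
  \sum_(j < n.+1) (s j * b j + j.+1%:R * t j.+1 * b j.+1) *: fbasis j.
Proof.
move=> linT TE b0.
pose lT : {linear {poly R} -> {poly R}} :=
  HB.pack T (GRing.isLinear.Build R {poly R} {poly R} _ T linT).
have TZ x p : T (x *: p) = x *: T p by exact: (linearZ_LR lT).
have -> : T (\sum_(j < n.+1) b j *: fbasis j) = \sum_(j < n.+1) T (b j *: fbasis j).
  exact: (linear_sum lT).
under eq_bigr => j _ do rewrite TZ TE scalerDr !scalerA.
under [RHS]eq_bigr => j _ do rewrite scalerDl.
rewrite !big_split /=; congr (_ + _).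
  by apply: eq_bigr => j _; rewrite mulrC.
rewrite [RHS]big_ord_recr /= b0 mulr0 scale0r addr0.
rewrite big_ord_recl /= mul0r mulr0 scale0r add0r.
by apply: eq_bigr => j _; rewrite /bump add1n mulrC.
Qed.

End FallingBasis.

(** * The Hahn operator on the basis (-x)_j *)

Section HahnPolynomials.
Variables (R : realType) (alpha c N : R).
Implicit Types (j n : nat) (p q : {poly R}).

(** The factor x of the backward coefficient is what makes [mulX_Nabla_fbasis]
    applicable to this form of D. *)
Lemma hahn_opE p :
  hahn_op alpha c N p =
  ('X + c%:P) * ('X - (N - 1)%:P) * Delta p - 'X * ('X - alpha%:P) * Nabla p
  + (alpha + c - N - 1) *: p.
Proof.
rewrite /hahn_op /Delta /Nabla shift0 -!mul_polyC.
rewrite !(polyC_natr, polyCN, polyCD, polyCM).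
by ring.
Qed.

Lemma hahn_op_is_linear : linear (hahn_op alpha c N).
Proof.
move=> x p q; rewrite !hahn_opE !linearP /= -!mul_polyC; ring.
Qed.

HB.instance Definition _ :=
  GRing.isLinear.Build R {poly R} {poly R} _ (hahn_op alpha c N)
    hahn_op_is_linear.

(** The contributions on (-x)_{j+1} of the forward and backward parts cancel:
    to leading order these parts are x^2 Delta and - x^2 Nabla. *)
Lemma hahn_op_fbasis j :
  hahn_op alpha c N (fbasis R j) =
  theta alpha c N j *: fbasis R j
  + (j%:R * ((N - j%:R) * (c + j%:R - 1))) *: fbasis R j.-1.
Proof.
rewrite hahn_opE Delta_fbasis.
rewrite (_ : 'X * ('X - alpha%:P) * _ =
  ('X - alpha%:P) * ('X * Nabla (fbasis R j))); last by ring.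
rewrite mulX_Nabla_fbasis.
case: j => [|j] /=.
  rewrite /theta !mul0r !scale0r oppr0 !mulr0 subrr add0r addr0.
  by congr (_ *: _); ring.
have := mulX_fbasis R j; have := mulX_fbasis R j.+1.
move: (fbasis R j) (fbasis R j.+1) (fbasis R j.+2) => e0 e1 e2 E1 E0.
have {}E0 : e1 = j%:R *: e0 - 'X * e0 by rewrite E0 opprB addrC subrK.
have {}E1 : e2 = j.+1%:R *: e1 - 'X * e1 by rewrite E1 opprB addrC subrK.
rewrite /theta E0 -!mul_polyC !(polyC_natr, polyCN, polyCD, polyCM) -!natr1 polyC1.
by ring.
Qed.

Lemma shift_Delta_fbasis j :
  (- 'X + (N - 1)%:P) * Delta (fbasis R j) =
  (- j%:R) *: fbasis R j + (j%:R * (j%:R - N)) *: fbasis R j.-1.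
Proof.
rewrite Delta_fbasis; case: j => [|j] /=.
  by rewrite !mul0r oppr0 !scale0r oppr0 mulr0 addr0.
have := mulX_fbasis R j.
move: (fbasis R j) (fbasis R j.+1) => e0 e1 E0.
have {E0} -> : e1 = j%:R *: e0 - 'X * e0 by rewrite E0 opprB addrC subrK.
rewrite -!mul_polyC !(polyC_natr, polyCN, polyCD, polyCM) -!natr1 polyC1.
by ring.
Qed.

End HahnPolynomials.

(** * Coefficients of the Hahn polynomials *)

Section HahnCoefficients.
Variables (R : realType) (alpha c N : R).
Hypothesis Hacn : forall m : nat, alpha + c - N != - (m.+1)%:R.
Implicit Types (j n : nat) (p q : {poly R}).

Definition hahn_coef n j : R :=
  poch (- n%:R) j * poch (1 - N + j%:R) (n - j) * poch (c + j%:R) (n - j)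
  / (poch (n%:R + alpha + c - N + j%:R) (n - j) * (j`!)%:R).

Lemma hahnE n : hahn alpha c N n = \sum_(j < n.+1) hahn_coef n j *: fbasis R j.
Proof. by []. Qed.

Lemma hahn_coef_gt n j : (n < j)%N -> hahn_coef n j = 0.
Proof. by move=> lt_nj; rewrite /hahn_coef poch_oppn // !mul0r. Qed.

Lemma den_neq0 n : n%:R + 1 + (alpha + c - N) != 0.
Proof. by rewrite natr1 addrC addr_eq0 Hacn. Qed.

Lemma poch_den_neq0 m n : poch (m%:R + 1 + (alpha + c - N)) n != 0.
Proof.
apply/prodf_neq0 => i _.
rewrite (_ : _ + i%:R = (m + i)%:R + 1 + (alpha + c - N)) ?den_neq0 //.
by rewrite natrD; ring.
Qed.

Let fact_neq0 i : (i`!)%:R != 0 :> R.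
Proof. by rewrite pnatr_eq0 -lt0n fact_gt0. Qed.

Lemma poch_oppn_shift n j :
  (n.+1%:R - j%:R) * poch (- n.+1%:R : R) j = n.+1%:R * poch (- n%:R) j.
Proof.
have := pochS (- n.+1%:R : R) j; rewrite pochSl.
rewrite (_ : - n.+1%:R + 1 = - n%:R :> R) => [E|]; last by rewrite -natr1; ring.
by apply: oppr_inj; rewrite -[RHS]mulNr E; ring.
Qed.

Lemma poch_oppnS n j :
  poch (- n.+1%:R : R) j.+1 = - (n.+1%:R * poch (- n%:R) j).
Proof. by rewrite pochSl -mulNr -natr1; congr (_ * poch _ _); ring. Qed.

(** The hypergeometric term ratio, multiplied out so that it survives the
    vanishing of 1 - N + j or c + j. *)
Lemma hahn_coef_ratio n j : (j < n)%N ->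
  j.+1%:R * (1 - N + j%:R) * (c + j%:R) * hahn_coef n j.+1 =
  (j%:R - n%:R) * (n%:R + alpha + c - N + j%:R) * hahn_coef n j.
Proof.
move=> lt_jn.
have [d nE] : exists d, n = (j + d).+1 by exists (n - j.+1)%N; lia.
have e1 : (n - j = d.+1)%N by lia.
have e2 : (n - j.+1 = d)%N by lia.
rewrite /hahn_coef e1 e2.
rewrite pochS !pochSl factS natrM.
rewrite (_ : 1 - N + j.+1%:R = 1 - N + j%:R + 1); last by rewrite -natr1; ring.
rewrite (_ : c + j.+1%:R = c + j%:R + 1); last by rewrite -natr1; ring.
rewrite (_ : _ + j.+1%:R = (n + j)%:R + 1 + (alpha + c - N)); last first.
  by rewrite natrD -natr1; ring.
rewrite (_ : _ + alpha + c - N + j%:R + 1 = (n + j)%:R + 1 + (alpha + c - N));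
  last by rewrite natrD; ring.
rewrite (_ : _ + alpha + c - N + j%:R = (j + d + j)%:R + 1 + (alpha + c - N));
  last by rewrite nE -natr1 !natrD; ring.
have := poch_den_neq0 (n + j) d; have := den_neq0 (j + d + j); have := fact_neq0 j.
move: (poch (_%:R + 1 + _) d) (poch (1 - N + _ + 1) d) (poch (c + _ + 1) d).
move: (poch _ j) => z p q r f0 d0 p0.
have j0 : j.+1%:R != 0 :> R by rewrite pnatr_eq0.
rewrite !natrD -!natr1 in j0 d0 *.
by field; rewrite f0 p0 j0 d0.
Qed.

(** The last index j = n - 1 at which both h_n and h_{n-1} have a coefficient.
    It is separate from [hahn_coef_below] because the common factor used there
    would have to be divided by (1 - N + j) (c + j), which can be zero. *)
Lemma hahn_coef_diag j (X := hahn_coef j j) :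
  [/\ j.+1%:R + j.+1%:R + (alpha + c - N) - 1 != 0,
      hahn_coef j.+1 j = X * j.+1%:R * (1 - N + j%:R) * (c + j%:R) /
        (j.+1%:R + j.+1%:R + (alpha + c - N) - 1)
    & hahn_coef j.+1 j.+1 = - X].
Proof.
have d0 : j.+1%:R + j.+1%:R + (alpha + c - N) - 1 != 0.
  by have := den_neq0 (j + j); rewrite natrD -natr1; apply: contra_neq => <-; ring.
have f0 := fact_neq0 j.
have j0 : j.+1%:R != 0 :> R by rewrite pnatr_eq0.
split=> //.
  rewrite /X /hahn_coef subSnn !subnn !poch0 !(pochS _ 0) !poch0.
  have := poch_oppn_shift j j; rewrite -natr1 addrAC subrr add0r mul1r => ->.
  by rewrite -natr1 in d0 *; field; rewrite f0 d0.
rewrite /X /hahn_coef !subnn !poch0 poch_oppnS factS natrM.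
by rewrite -natr1 in j0 *; field; rewrite f0 j0.
Qed.

(** The four coefficients that meet in the first-order relations are rational
    multiples of one number X, so that those relations become identities of
    rational functions.  Indexing by j and d, with n = j + d + 2, gives every
    Pochhammer symbol the length d, d + 1 or d + 2, free of truncated
    differences. *)
Lemma hahn_coef_below j d (m := (j + d).+1) (n := m.+1)
    (s := n%:R + n%:R + (alpha + c - N)) :
  [/\ s - 1 != 0, s - 2%:R != 0, n%:R + (alpha + c - N) - 1 + j%:R != 0 &
  exists X,
  [/\ hahn_coef n j = X * n%:R * (1 - N + j%:R) * (n%:R - N) * (c + j%:R)
        * (c + n%:R - 1) / ((n%:R - j%:R) * (s - 2%:R) * (s - 1)),
      hahn_coef n j.+1 = - X * n%:R * (n%:R - N) * (c + n%:R - 1)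
        * (n%:R + (alpha + c - N) + j%:R) / (j.+1%:R * (s - 2%:R) * (s - 1)),
      hahn_coef m j = X * (1 - N + j%:R) * (c + j%:R)
        / (n%:R + (alpha + c - N) - 1 + j%:R)
    & hahn_coef m j.+1 = X * (j%:R - m%:R) / j.+1%:R]].
Proof.
have [s1 s2 m0] : [/\ s - 1 != 0, s - 2%:R != 0
    & n%:R + (alpha + c - N) - 1 + j%:R != 0].
  split.
  - have := den_neq0 (m + m); apply: contra_neq => <-.
    by rewrite /s /n natrD -natr1; ring.
  - have := den_neq0 (m + (j + d)); apply: contra_neq => <-.
    by rewrite /s /n /m natrD -!natr1; ring.
  have := den_neq0 (j + d + j); apply: contra_neq => <-.
  by rewrite /n /m natrD -!natr1; ring.
split=> //.
have f0 := fact_neq0 j.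
have j0 : j.+1%:R != 0 :> R by rewrite pnatr_eq0.
have nj0 : n%:R - j%:R != 0 :> R.
  by rewrite subr_eq0 eqr_nat; lia.
pose a := alpha + c - N.
pose Q := poch (n%:R + a + j%:R) d.
have Q0 : Q != 0.
  have := poch_den_neq0 (m + j) d; congr (poch _ d != 0).
  by rewrite /n natrD -natr1 /a; ring.
have Qn : poch (n%:R + alpha + c - N + j%:R) d.+2 = Q * (s - 2%:R) * (s - 1).
  rewrite !pochS /Q (_ : n%:R + alpha + c - N + j%:R = n%:R + a + j%:R).
  by rewrite /s /n /m -!natr1 natrD /a; congr (_ * _ * _); ring.
  by rewrite /a; ring.
have Qm : poch (m%:R + alpha + c - N + j%:R) d.+1
    = (n%:R + a - 1 + j%:R) * Q.
  rewrite pochSl /Q /n -natr1 /a; congr (_ * poch _ _); ring.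
have QnS : (n%:R + a + j%:R) * poch (n%:R + alpha + c - N + j.+1%:R) d.+1
    = Q * (s - 2%:R) * (s - 1).
  rewrite -Qn [RHS]pochSl /a -!natr1; congr (_ * poch _ _); ring.
have QmS : poch (m%:R + alpha + c - N + j.+1%:R) d = Q.
  by rewrite /Q /n /a -!natr1; congr (poch _ _); ring.
pose p := poch (1 - N + j%:R + 1) d; pose q := poch (c + j%:R + 1) d.
have pS (y : R) : poch (y + j%:R) d.+1 = (y + j%:R) * poch (y + j%:R + 1) d.
  exact: pochSl.
have pSS (y : R) : poch (y + j%:R) d.+2 =
    (y + j%:R) * poch (y + j%:R + 1) d * (y + n%:R - 1).
  by rewrite pochSl pochS mulrA /n /m -!natr1 natrD; congr (_ * _); ring.
have pS1 (y : R) : poch (y + j.+1%:R) d = poch (y + j%:R + 1) d.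
  by rewrite -natr1 addrA.
have pSS1 (y : R) :
    poch (y + j.+1%:R) d.+1 = poch (y + j%:R + 1) d * (y + n%:R - 1).
  by rewrite pochS /n /m -!natr1 natrD addrA; congr (_ * _); ring.
(* X collects the Pochhammer factors shared by the four coefficients. *)
exists (poch (- m%:R) j * p * q / (Q * (j`!)%:R)).
have na0 : n%:R + a + j%:R != 0.
  have := den_neq0 (m + j); apply: contra_neq => <-.
  by rewrite /n natrD -natr1 /a; ring.
have e1 : (n - j = d.+2)%N by lia.
have e2 : (n - j.+1 = d.+1)%N by lia.
have e3 : (m - j = d.+1)%N by lia.
have e4 : (m - j.+1 = d)%N by lia.
rewrite /hahn_coef e1 e2 e3 e4 Qn Qm QmS.
have -> : poch (n%:R + alpha + c - N + j.+1%:R) d.+1 =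
    Q * (s - 2%:R) * (s - 1) / (n%:R + a + j%:R).
  by rewrite -QnS mulrC mulKf.
rewrite !pS !pSS !pS1 !pSS1 -/p -/q.
have -> : poch (- n%:R : R) j = n%:R * poch (- m%:R) j / (n%:R - j%:R).
  by rewrite -poch_oppn_shift mulrC mulKf.
rewrite poch_oppnS [poch _ j.+1]pochS factS natrM -/a.
move: (poch _ j) => z; move: s1 s2 na0 m0 nj0 j0; rewrite -/a.
have {}nE : n%:R = m%:R + 1 :> R by rewrite -natr1.
rewrite /s !nE; move: (m%:R : R) (j.+1%:R : R) (j%:R : R) => M J1 J.
move: (p) (q) (Q) Q0 (j`!%:R) f0 => p' q' Q' Q0 f f0 s1 s2 na0 m0 nj0 j0.
by split; field; rewrite ?f0 ?Q0 ?j0 ?s1 ?s2 ?na0 ?m0 ?nj0.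
Qed.

End HahnCoefficients.

(** * First-order relations between consecutive Hahn polynomials *)

Section CoefficientRelations.
Variables (R : realType) (alpha c N : R).
Hypothesis Hacn : forall m : nat, alpha + c - N != - (m.+1)%:R.
Implicit Types (j n : nat) (p q : {poly R}).
Local Notation a := (alpha + c - N).
Local Notation hahn_coef := (hahn_coef alpha c N).
Local Notation hahn := (hahn alpha c N).

Lemma hahn_eigen n :
  hahn_op alpha c N (hahn n) = theta alpha c N n *: hahn n.
Proof.
rewrite hahnE (lowering_fbasis (hahn_op_is_linear _ _ _)
  (hahn_op_fbasis alpha c N)) ?hahn_coef_gt //.
rewrite scaler_sumr; apply: eq_bigr => j _; rewrite scalerA; congr (_ *: _).
have [lt_jn|lt_nj|->] := ltngtP j n.
- have := hahn_coef_ratio Hacn lt_jn; rewrite /theta -!natr1.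
  move: (hahn_coef n j) (hahn_coef n j.+1) => x y E.
  rewrite (_ : _ * y = - ((j%:R + 1) * (1 - N + j%:R) * (c + j%:R) * y));
    last by ring.
  by rewrite E; ring.
- by have := ltn_ord j; lia.
- by rewrite (@hahn_coef_gt _ _ _ _ n n.+1) // mulr0 addr0.
Qed.

(** The coefficients of h_{n+1} + e h_n on (-x)_j. *)
Definition sum_coef (e : R) n j := hahn_coef n.+1 j + e * hahn_coef n j.

(** The coefficients of (n + 1) h_{n+1} - e (n + a) h_n on (-x)_j. *)
Definition diff_coef (e : R) n j :=
  n.+1%:R * hahn_coef n.+1 j - e * (n%:R + a) * hahn_coef n j.

(** [eps1 n] and [eps2 n] are the values that make [Delta_coef] and
    [Nabla_coef] hold; multiplied by gamma_{n+1} / gamma_n they give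
    beta_{n,1} and beta_{n,2}. *)
Definition eps1 n : R :=
  n%:R * (N - n%:R) * (n%:R + alpha - N) / beta_den alpha c N n.

Definition eps2 n : R :=
  n%:R * (n%:R + alpha - N) * (n%:R + alpha + c - 1) / beta_den alpha c N n.

(** For j < n, j = n and j = n + 1 the two relevant coefficients of h_n are both
    there, only one is, or none is.  The case j = n with n = 0 needs the factor
    2 n + a of [beta_den], which is then a, to be nonzero. *)
Lemma Delta_coef n j : beta_den alpha c N n.+1 != 0 -> (j <= n.+1)%N ->
  let e := eps1 n.+1 in
  - j%:R * sum_coef e n j + j.+1%:R * (j.+1%:R - N) * sum_coef e n j.+1
  = - diff_coef e n j.
Proof.
move=> b0 le_jn /=; move: (b0).
rewrite /beta_den mulf_eq0 negb_or => /andP[b1 b2].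
rewrite /eps1 /beta_den /sum_coef /diff_coef; have [lt_jn|lt_nj|->] := ltngtP j n.
- have [d nE] : exists d, n = (j + d).+1 by exists (n - j.+1)%N; lia.
  have [] := hahn_coef_below Hacn j d; rewrite -nE.
  have j0 : j.+1%:R != 0 :> R by rewrite pnatr_eq0.
  have nj0 : n.+1%:R - j%:R != 0 :> R by rewrite subr_eq0 eqr_nat; lia.
  move=> s1 s2 s3 [X [-> -> -> ->]].
  rewrite -[n.+1%:R]natr1 -[j.+1%:R]natr1 in b1 b2 s1 s2 s3 j0 nj0 *.
  by field; rewrite ?b1 ?b2 ?s1 ?s2 ?s3 ?j0 ?nj0.
- have -> : j = n.+1 by lia.
  rewrite !(@hahn_coef_gt _ _ _ _ n) // (@hahn_coef_gt _ _ _ _ n.+1 n.+2) //.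
  by ring.
have [s1 -> ->] := hahn_coef_diag Hacn n.
rewrite (@hahn_coef_gt _ _ _ _ n n.+1) //.
rewrite -[n.+1%:R]natr1 in b1 b2 s1 *.
by field; rewrite ?b1 ?b2 ?s1.
Qed.

Lemma Nabla_coef n j : beta_den alpha c N n.+1 != 0 -> (j <= n.+1)%N ->
  let e := eps2 n.+1 in
  j.+1%:R * ((j.+1%:R - alpha) * sum_coef e n j.+1 - diff_coef e n j.+1)
  = j%:R * sum_coef e n j - diff_coef e n j.
Proof.
move=> b0 le_jn /=; move: (b0).
rewrite /beta_den mulf_eq0 negb_or => /andP[b1 b2].
rewrite /eps2 /beta_den /sum_coef /diff_coef; have [lt_jn|lt_nj|->] := ltngtP j n.
- have [d nE] : exists d, n = (j + d).+1 by exists (n - j.+1)%N; lia.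
  have [] := hahn_coef_below Hacn j d; rewrite -nE.
  have j0 : j.+1%:R != 0 :> R by rewrite pnatr_eq0.
  have nj0 : n.+1%:R - j%:R != 0 :> R by rewrite subr_eq0 eqr_nat; lia.
  move=> s1 s2 s3 [X [-> -> -> ->]].
  rewrite -[n.+1%:R]natr1 -[j.+1%:R]natr1 in b1 b2 s1 s2 s3 j0 nj0 *.
  by field; rewrite ?b1 ?b2 ?s1 ?s2 ?s3 ?j0 ?nj0.
- have -> : j = n.+1 by lia.
  rewrite !(@hahn_coef_gt _ _ _ _ n) // (@hahn_coef_gt _ _ _ _ n.+1 n.+2) //.
  by ring.
have [s1 -> ->] := hahn_coef_diag Hacn n.
rewrite (@hahn_coef_gt _ _ _ _ n n.+1) //.
rewrite -[n.+1%:R]natr1 in b1 b2 s1 *.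
by field; rewrite ?b1 ?b2 ?s1.
Qed.

End CoefficientRelations.

Section FirstOrderRelations.
Variables (R : realType) (alpha c N : R).
Hypothesis Hacn : forall m : nat, alpha + c - N != - (m.+1)%:R.
Implicit Types (j n : nat) (p q : {poly R}).
Local Notation a := (alpha + c - N).
Local Notation hahn_coef := (hahn_coef alpha c N).
Local Notation hahn := (hahn alpha c N).

Lemma hahn_pairE n (x y : R) :
  x *: hahn n.+1 + y *: hahn n =
  \sum_(j < n.+2) (x * hahn_coef n.+1 j + y * hahn_coef n j) *: fbasis R j.
Proof.
have -> : hahn n = \sum_(j < n.+2) hahn_coef n j *: fbasis R j.
  by rewrite big_ord_recr /= hahn_coef_gt // scale0r addr0.
rewrite hahnE !scaler_sumr -big_split; apply: eq_bigr => j _ /=.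
by rewrite scalerDl !scalerA.
Qed.

Lemma hahn_Delta n (e := eps1 alpha c N n.+1) :
  beta_den alpha c N n.+1 != 0 ->
  (- 'X + (N - 1)%:P) * Delta (hahn n.+1 + e *: hahn n)
  = e * (n%:R + a) *: hahn n - n.+1%:R *: hahn n.+1.
Proof.
move=> b0; rewrite -[hahn n.+1 in LHS]scale1r hahn_pairE.
rewrite [RHS]addrC -scaleNr hahn_pairE.
have linT : linear (fun p => (- 'X + (N - 1)%:P) * Delta p).
  by move=> x p q; rewrite linearP mulrDr scalerAr.
under eq_bigr => j _ do rewrite mul1r -/(sum_coef _ _ _ e n j).
rewrite (lowering_fbasis linT (shift_Delta_fbasis N)).
  apply: eq_bigr => j _; congr (_ *: _).
  rewrite (Delta_coef Hacn b0 (ltn_ord j : (j <= n.+1)%N)) /diff_coef.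
  by rewrite opprB addrC mulNr.
by rewrite /sum_coef !hahn_coef_gt // mulr0 addr0.
Qed.

(** Nabla (-x)_j does not expand in few of the (-x)_i, but x Nabla (-x)_j does.
    So both sides are multiplied by x, and after reindexing the coefficient on
    (-x)_{j+1} is the difference of the two sides of [Nabla_coef]. *)
Lemma hahn_Nabla n (e := eps2 alpha c N n.+1) :
  beta_den alpha c N n.+1 != 0 ->
  ('X - alpha%:P) * Nabla (hahn n.+1 + e *: hahn n)
  = n.+1%:R *: hahn n.+1 - e * (n%:R + a) *: hahn n.
Proof.
move=> b0; apply: (mulfI (negbT (polyX_eq0 R))).
rewrite -[hahn n.+1 in LHS]scale1r -scaleNr !hahn_pairE.
under eq_bigr => j _ do rewrite mul1r -/(sum_coef _ _ _ e n j).
under [in RHS]eq_bigr => j _ do rewrite mulNr -/(diff_coef _ _ _ e n j).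
rewrite mulrCA linear_sum /= !mulr_sumr; apply/eqP; rewrite -subr_eq0 -sumrB.
pose A := sum_coef alpha c N e n; pose G := diff_coef alpha c N e n.
have A0 : A n.+2 = 0 by rewrite /A /sum_coef !hahn_coef_gt // mulr0 addr0.
have G0 : G n.+2 = 0 by rewrite /G /diff_coef !hahn_coef_gt // !mulr0 subr0.
under eq_bigr => j _.
  rewrite -/(A j) -/(G j) linearZ /= -scalerAr mulX_Nabla_fbasis -!scalerAr.
  rewrite mulrBl mulX_fbasis mul_polyC.
  rewrite (_ : _ - _ = (j%:R * ((j%:R - alpha) * A j - G j)) *: fbasis R j
    - (j%:R * A j - G j) *: fbasis R j.+1); last first.
    rewrite -!mul_polyC !(polyCD, polyCN, polyCM) polyC_natr; ring.
  over.
rewrite sumrB big_ord_recl mul0r scale0r add0r.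
rewrite [X in _ - X](_ : _ = \sum_(j < n.+2)
   (j.+1%:R * ((j.+1%:R - alpha) * A j.+1 - G j.+1)) *: fbasis R j.+1).
  rewrite [X in _ - X]big_ord_recr /= A0 G0.
  by rewrite !mulr0 subrr mulr0 scale0r addr0 subrr.
apply: eq_bigr => j _; congr (_ *: _).
by rewrite -(Nabla_coef Hacn b0 (ltn_ord j : (j <= n.+1)%N)).
Qed.

End FirstOrderRelations.

(** * The recurrence satisfied by P1 at the eigenvalues *)

Section Eigenvalues.
Variables (R : realType) (alpha c N : R).
Implicit Types (j k n : nat) (w : nat -> R).
Local Notation a := (alpha + c - N).
Local Notation theta := (theta alpha c N).
Local Notation sigma := (sigma alpha c N).
Local Notation gamma := (gamma alpha c N).
Local Notation r_poly := (r_poly alpha c N).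
Local Notation u := (u alpha c N).

Lemma r_poly_theta j n : (r_poly j).[theta n] = u j n.+1.
Proof.
rewrite /r_poly /u hornerZ horner_prod -[in (-1) ^+ j](card_ord j) -prodr_const.
rewrite /poch -!big_split; apply: eq_bigr => i _.
by rewrite /= hornerD hornerX hornerC /theta -natr1; ring.
Qed.

Lemma gamma_theta k w n :
  gamma k w n.+1 = (\sum_(j < k.+1) w j *: r_poly j).[theta n].
Proof.
by rewrite horner_sum; apply: eq_bigr => j _; rewrite hornerZ r_poly_theta.
Qed.

(** The discrete antiderivative behind the choice of P1: it exhibits
    n u_j (n+1) + (n + a - 1) u_j (n) as a difference, after division by j + 1.
    This is where the weights w_j / (j + 1) come from. *)
Lemma u_recurrence j n :
  n.+1%:R * (n.+1%:R + a) * u j n.+2 - n%:R * (n%:R + a) * u j n.+1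
  = j.+1%:R * (n.+1%:R * u j n.+2 + (n%:R + a) * u j n.+1).
Proof.
rewrite /u; case: j => [|j]; first by rewrite !poch0 -!natr1; ring.
rewrite [poch n.+2%:R _]pochS [poch n.+1%:R _]pochSl.
rewrite [poch (- n.+2%:R - _ - _ + _ + _) _]pochSl.
rewrite [poch (- n.+1%:R - _ - _ + _ + _) _]pochS.
have -> : - n.+2%:R - alpha - c + N + 2%:R + 1 = - n.+1%:R - alpha - c + N + 2%:R.
  by rewrite -[n.+2%:R]natr1; ring.
have -> : n.+1%:R + 1 = n.+2%:R :> R by rewrite natr1.
move: (poch _ _) (poch _ _) => x y.
by rewrite -[n.+2%:R]natr1 -[n.+1%:R]natr1 -[j.+2%:R]natr1 -[j.+1%:R]natr1; ring.
Qed.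

(** The polynomial P1 of the theorem, with P2 written through its weights. *)
Definition P1_poly k w : {poly R} :=
  a *: (\sum_(j < k.+1) w j *: r_poly j)
  + 2%:R *: ('X - (a - 1)%:P)
    * \sum_(j < k.+1) (w j / (j.+1)%:R) *: r_poly j.

(** theta_n - (a - 1) = n (n + a), so the second summand of P1 at theta_n is
    twice the quantity differenced in [u_recurrence]. *)
Lemma P1_step k w n :
  (P1_poly k w).[theta n.+1] - (P1_poly k w).[theta n]
  = sigma n.+2 * gamma k w n.+2 + sigma n.+1 * gamma k w n.+1.
Proof.
rewrite /P1_poly !(hornerD, hornerZ, hornerM, hornerN, hornerX, hornerC).
rewrite -!gamma_theta.
pose S m := \sum_(j < k.+1) w j / j.+1%:R * u j m.+1.
have SE m : (\sum_(j < k.+1) (w j / (j.+1)%:R) *: r_poly j).[theta m] = S m.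
  by rewrite horner_sum; apply: eq_bigr => j _; rewrite hornerZ r_poly_theta.
rewrite !SE.
have E : n.+1%:R * (n.+1%:R + a) * S n.+1 - n%:R * (n%:R + a) * S n
    = n.+1%:R * gamma k w n.+2 + (n%:R + a) * gamma k w n.+1.
  rewrite /S /gamma !mulr_sumr -sumrB -big_split; apply: eq_bigr => j _ /=.
  have j0 : j.+1%:R != 0 :> R by rewrite pnatr_eq0.
  rewrite [LHS](_ : _ = w j / j.+1%:R * (n.+1%:R * (n.+1%:R + a) * u j n.+2
    - n%:R * (n%:R + a) * u j n.+1)); last by ring.
  by rewrite u_recurrence mulrA divfK //; ring.
rewrite [LHS](_ : _ = a * (gamma k w n.+2 - gamma k w n.+1) +
   2%:R * (n.+1%:R * (n.+1%:R + a) * S n.+1 - n%:R * (n%:R + a) * S n)); last first.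
  by rewrite /theta -!natr1; ring.
by rewrite E /sigma -!natr1; ring.
Qed.

Lemma r_poly_lead j : size (r_poly j) = j.+1 /\ lead_coef (r_poly j) = (-1) ^+ j.
Proof.
have mon : \prod_(i < j) ('X + (i%:R * (a - 2%:R - i%:R))%:P) \is monic.
  apply: monic_prod => i _; rewrite monicE lead_coefDl ?lead_coefX //.
  by rewrite size_polyX size_polyC; case: eqP.
split; last by rewrite lead_coefZ (monicP mon) mulr1.
rewrite size_scale ?signr_eq0 // size_prod.
  under eq_bigr => i _ do rewrite size_XaddC.
  by rewrite sum_nat_const card_ord; lia.
by move=> i _; rewrite -size_poly_gt0 size_XaddC.
Qed.

Lemma size_r_poly_sum_le k w :
  (size (\sum_(j < k) w j *: r_poly j)%R <= k)%N.
Proof.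
apply: leq_trans (size_sum _ _ _) _; apply/bigmax_leqP => j _.
by apply: leq_trans (size_scale_leq _ _) _; have [->] := r_poly_lead j.
Qed.

Lemma size_r_poly_sum k w : w k != 0 ->
  size (\sum_(j < k.+1) w j *: r_poly j) = k.+1.
Proof.
move=> wk; have top : size (w k *: r_poly k) = k.+1.
  by rewrite size_scale //; have [] := r_poly_lead k.
by rewrite big_ord_recr /= addrC size_polyDl top // ltnS size_r_poly_sum_le.
Qed.

Lemma size_P1_poly k w :
  size (\sum_(j < k.+1) w j *: r_poly j) = k.+1 -> size (P1_poly k w) = k.+2.
Proof.
move=> sP2.
have wk : w k != 0.
  apply: contra_eq_neq sP2 => wk0; rewrite big_ord_recr /= wk0 scale0r addr0.
  by rewrite ltn_eqF // ltnS size_r_poly_sum_le.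
pose v j := w j / j.+1%:R.
have vk : v k != 0 by rewrite mulf_neq0 ?invr_eq0 ?pnatr_eq0.
have sS := size_r_poly_sum vk.
have sX : size (2%:R *: ('X - (a - 1)%:P)) = 2%N.
  by rewrite size_scale ?size_XsubC // pnatr_eq0.
have sM : size (2%:R *: ('X - (a - 1)%:P) * \sum_(j < k.+1) v j *: r_poly j) = k.+2.
  by rewrite size_mul -?size_poly_gt0 ?sX ?sS.
rewrite /P1_poly addrC size_polyDl ?sM //.
by apply: leq_ltn_trans (size_scale_leq _ _) _; rewrite sP2.
Qed.

End Eigenvalues.

(** * Genre of the operators *)

Section Genre.
Variables (R : realType) (alpha c N : R) (k : nat) (P1 P2 : {poly R}).
Hypotheses (size_P1 : size P1 = k.+2) (size_P2 : size P2 = k.+1).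
Let A : {poly R} := 'X * ('X - alpha%:P).
Let B : {poly R} := - 2%:R *: 'X^2 + (alpha - c + N - 1) *: 'X
     + (alpha + N * (c - 1) - 1)%:P.
Let C : {poly R} := ('X + c%:P) * ('X - (N - 1)%:P).
Let T := hahn_op alpha c N.
Let g P l := poly_op_coef A B C P l.

Let size_A : size A = 3%N.
Proof. by rewrite size_mul -?size_poly_gt0 ?size_polyX ?size_XsubC. Qed.

Let size_C : size C = 3%N.
Proof. by rewrite size_mul -?size_poly_gt0 ?size_XaddC ?size_XsubC. Qed.

Let TE p : T p = A * shift (-1) p + B * shift 0 p + C * shift 1 p.
Proof. by []. Qed.

Let repP (P : {poly R}) m : size P = m.+1 -> represents m (g P) (poly_op P T).
Proof. by move=> sP; apply: represents_poly_op; rewrite ?sP. Qed.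

(** Shifting P2 (D) by one step gives it the same window as P1 (D), so at the
    extreme shifts the coefficients are compared by degree: 2 (k + 1) for P1 (D)
    against at most 1 + 2 k for the other terms. *)
Lemma first_order_genre (x : R) (W1 W0 WN : {poly R}) (S : {poly R} -> {poly R}) :
  x != 0 -> (size W1 <= 2)%N -> (size WN <= 2)%N ->
  (forall p, S p = x *: poly_op P1 T p + (W1 * shift 1 (poly_op P2 T p)
     + (W0 * poly_op P2 T p + WN * shift (-1) (poly_op P2 T p)))) ->
  has_genre S (- (k.+1)%:Z) (k.+1)%:Z.
Proof.
move=> x0 sW1 sWN SE.
have rep2 := repP size_P2; have [g2_0 _] := rep2.
have [f0 fE] := representsD (representsM x%:P (repP size_P1))
  (representsD (representsM W1 (represents_shift1 rep2))
    (representsD (representsM W0 (represents_widen (leqnSn k) rep2))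
      (representsM WN (represents_shiftN1 rep2)))).
have repS : represents k.+1 (fun l => x%:P * g P1 l
   + (W1 * shift 1 (g P2 (l - 1))
      + (W0 * g P2 l + WN * shift (-1) (g P2 (l + 1))))) S.
  by split=> // p; rewrite SE -mul_polyC fE.
have lt2 (W : {poly R}) l l' : (size W <= 2)%N -> l = k%:Z \/ l = - k%:Z ->
    (size (W * shift l' (g P2 l))%R < k.+1.*2.+1)%N.
  move=> sW lk; apply: leq_ltn_trans (size_polyMleq _ _) _.
  by rewrite size_shift (size_poly_op_coef size_A size_C TE size_P2 lk); lia.
have s1 l : l = k.+1%:Z \/ l = - k.+1%:Z -> size (x%:P * g P1 l) = k.+1.*2.+1.
  move=> lk; rewrite mul_polyC size_scale //.
  exact: (size_poly_op_coef size_A size_C TE size_P1 lk).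
apply: (represents_genre repS); rewrite -size_poly_gt0.
- rewrite (g2_0 (- k.+1%:Z)) ?(g2_0 (- k.+1%:Z - 1)); try lia.
  rewrite linear0 !mulr0 !add0r.
  rewrite size_polyDl s1 //; try by right.
  by apply: lt2 => //; lia.
- rewrite (g2_0 k.+1%:Z) ?(g2_0 (k.+1%:Z + 1)); try lia.
  rewrite linear0 !mulr0 !addr0.
  rewrite size_polyDl s1 //; try by left.
  by apply: lt2 => //; lia.
Qed.

Lemma D1_genre : has_genre (D1 alpha c N P1 P2) (- (k.+1)%:Z) (k.+1)%:Z.
Proof.
apply: (@first_order_genre 2%:R^-1 (- 'X + (N - 1)%:P)
  (- ((alpha + c - N) / 2%:R)%:P - (- 'X + (N - 1)%:P)) 0).
- by rewrite invr_eq0 pnatr_eq0.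
- by rewrite -size_polyN opprD opprK -polyCN size_XaddC.
- by rewrite size_poly0.
by move=> p; rewrite /D1 /Delta -!mul_polyC polyCN; ring.
Qed.

Lemma D2_genre : has_genre (D2 alpha c N P1 P2) (- (k.+1)%:Z) (k.+1)%:Z.
Proof.
apply: (@first_order_genre 2%:R^-1 0
  (- ((alpha + c - N) / 2%:R)%:P - ('X - alpha%:P)) ('X - alpha%:P)).
- by rewrite invr_eq0 pnatr_eq0.
- by rewrite size_poly0.
- by rewrite size_XsubC.
by move=> p; rewrite /D2 /Nabla -!mul_polyC; ring.
Qed.

End Genre.

(** * Polynomials in an operator *)

Section PolyOp.
Variable R : realType.
Implicit Types (p P : {poly R}).

Lemma iter_linear (T : {linear {poly R} -> {poly R}}) j (x : R) p q :
  iter j T (x *: p + q) = x *: iter j T p + iter j T q.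
Proof. by elim: j => //= j ->; rewrite linearP. Qed.

Lemma poly_opP (T : {linear {poly R} -> {poly R}}) P (x : R) p q :
  poly_op P T (x *: p + q) = x *: poly_op P T p + poly_op P T q.
Proof.
rewrite /poly_op scaler_sumr -big_split; apply: eq_bigr => j _.
by rewrite iter_linear scalerDr !scalerA mulrC.
Qed.

Lemma poly_op_eigen (T : {linear {poly R} -> {poly R}}) P (t : R) p :
  T p = t *: p -> poly_op P T p = P.[t] *: p.
Proof.
move=> Tp; rewrite /poly_op horner_coef scaler_suml; apply: eq_bigr => j _.
rewrite -scalerA; congr (_ *: _).
by elim: (j : nat) => [|i /= ->]; rewrite ?scale1r // linearZ /= Tp scalerA exprSr.
Qed.

End PolyOp.

(** * Eigenvectors *)

Section PairEigenvectors.
Variables (R : realType) (alpha c N : R).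
Hypothesis Hacn : forall m : nat, alpha + c - N != - (m.+1)%:R.
Variables (k : nat) (w : nat -> R) (P2 P1 : {poly R}).
Hypothesis P2E : P2 = \sum_(j < k.+1) w j *: r_poly alpha c N j.
Hypothesis P1E : P1 = P1_poly alpha c N k w.
Local Notation a := (alpha + c - N).
Local Notation hahn := (hahn alpha c N).
Local Notation gamma := (gamma alpha c N k w).
Local Notation T := (hahn_op alpha c N).
Local Notation lambda := (lambda alpha c N k w P1 P2).

Lemma hahn0 : hahn 0 = 1.
Proof.
by rewrite hahnE big_ord1 /hahn_coef /fbasis !poch0 fact0 !mulr1 divr1 scale1r.
Qed.

Lemma poly_op_pair P n (y : R) :
  poly_op P T (hahn n.+1 + y *: hahn n) =
  P.[theta alpha c N n.+1] *: hahn n.+1 + (y * P.[theta alpha c N n]) *: hahn n.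
Proof.
rewrite addrC poly_opP !(poly_op_eigen _ (hahn_eigen Hacn _)) scalerA.
by rewrite addrC.
Qed.

(** Here b (gamma n.+1) = e (gamma n.+2), which is what makes P2 (D) q a
    multiple of h_{n+1} + e h_n.  The number e is free: both families q_{n,1}
    and q_{n,2} are instances, and both lead to the same left-hand side once the
    first-order relation has been applied. *)
Lemma pair_eigen n (e : R) (b := e * (gamma n.+2 / gamma n.+1))
    (q := hahn n.+1 + b *: hahn n) :
  gamma n.+1 != 0 ->
  poly_op P2 T q = gamma n.+2 *: (hahn n.+1 + e *: hahn n) /\
  2%:R^-1 *: poly_op P1 T q - (a / 2%:R) *: poly_op P2 T q
   - gamma n.+2 *: (n.+1%:R *: hahn n.+1 - e * (n%:R + a) *: hahn n)
  = lambda n.+1 *: q.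
Proof.
move=> g0.
have P2q : poly_op P2 T q = gamma n.+2 *: (hahn n.+1 + e *: hahn n).
  rewrite poly_op_pair P2E -!gamma_theta scalerDr scalerA /b.
  by congr (_ + _ *: _); rewrite mulrA divfK // mulrC.
split=> //; rewrite P2q poly_op_pair /q /lambda P1E.
have -> : (P1_poly alpha c N k w).[theta alpha c N n.+1] =
   (P1_poly alpha c N k w).[theta alpha c N n]
   + (sigma alpha c N n.+2 * gamma n.+2 + sigma alpha c N n.+1 * gamma n.+1).
  by rewrite -P1_step; ring.
have bE : e * gamma n.+2 = b * gamma n.+1 by rewrite /b; field.
rewrite !(scalerDr, scalerBr, scalerA) -!addrA.
set h1 := hahn n.+1; set h0 := hahn n; set p := (_).[_].
set s2 := sigma alpha c N n.+2; set s1 := sigma alpha c N n.+1.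
rewrite [LHS](_ : _ =
  (2%:R^-1 * (p + (s2 * gamma n.+2 + s1 * gamma n.+1))
   - a / 2%:R * gamma n.+2 - gamma n.+2 * n.+1%:R) *: h1
  + (2%:R^-1 * (b * p) - a / 2%:R * (e * gamma n.+2)
     + (n%:R + a) * (e * gamma n.+2)) *: h0); last first.
  by rewrite -!mul_polyC !(polyCD, polyCN, polyCM); ring.
by congr (_ *: _ + _ *: _); rewrite ?bE /s1 /s2 /sigma -!natr1; field.
Qed.

End PairEigenvectors.

(* The hypothesis on beta_den in the eigenvalue equations says that beta_n is
   defined.  Under Hacn it can only fail for n = 1 and alpha + c - N = 0. *)
Theorem theorem7p3 (R : realType) (alpha c N : R)
  (Hacn : forall m : nat, alpha + c - N != - (m.+1)%:R)
  (k : nat) (Hk : (1 <= k)%N) (w : nat -> R) (P1 P2 : {poly R})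
  (HdegP2 : size P2 = k.+1)
  (HP2 : P2 = \sum_(j < k.+1) w j *: r_poly alpha c N j)
  (HP1 : P1 = (alpha + c - N) *: P2
              + 2%:R *: ('X - (alpha + c - N - 1)%:P)
                * \sum_(j < k.+1) (w j / (j.+1)%:R) *: r_poly alpha c N j)
  (Hgamma : forall n : nat, (1 <= n)%N -> gamma alpha c N k w n != 0) :
  [/\ size P1 = k.+2,
      has_genre (D1 alpha c N P1 P2) (- (k.+1)%:Z) (k.+1)%:Z,
      has_genre (D2 alpha c N P1 P2) (- (k.+1)%:Z) (k.+1)%:Z &
      forall n : nat, ((1 <= n)%N -> beta_den alpha c N n != 0) ->
        let q1 := q_poly alpha c N (beta1 alpha c N k w) n in
        let q2 := q_poly alpha c N (beta2 alpha c N k w) n in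
        let lambda_n := lambda alpha c N k w P1 P2 n in
        D1 alpha c N P1 P2 q1 = lambda_n *: q1 /\
        D2 alpha c N P1 P2 q2 = lambda_n *: q2].
Proof.
have P1E : P1 = P1_poly alpha c N k w by rewrite HP1 HP2.
have size1 : size P1 = k.+2 by rewrite P1E size_P1_poly // -HP2.
split=> //; [exact: D1_genre | exact: D2_genre |].
(* For n = 0 both differences annihilate the constant q_0 = 1. *)
case=> [_|n /(_ isT) b0] /=.
  have P_1 P : poly_op P (hahn_op alpha c N) 1 = P.[theta alpha c N 0] *: 1.
    by apply: poly_op_eigen; have := hahn_eigen Hacn 0; rewrite hahn0.
  rewrite /D1 /D2 !P_1 !linearZ /= /Delta /Nabla /shift !comp_polyC !subrr.
  rewrite !scaler0 !mulr0 !addr0 /lambda /sigma.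
  by split; rewrite !scalerA -?scalerDl -?scalerBl; congr (_ *: _); field.
have g0 := Hgamma n.+1 isT.
split.
- have -> : beta1 alpha c N k w n.+1 =
      eps1 alpha c N n.+1 * (gamma alpha c N k w n.+2 / gamma alpha c N k w n.+1).
    by [].
  have [P2q <-] := pair_eigen Hacn HP2 P1E (eps1 alpha c N n.+1) g0.
  rewrite /D1 [in Delta _]P2q linearZ /= -scalerAr hahn_Delta //.
  by rewrite scaleNr addrA; congr (_ + _); rewrite -[RHS]scalerN [- (_ - _)]opprB.
have -> : beta2 alpha c N k w n.+1 =
    eps2 alpha c N n.+1 * (gamma alpha c N k w n.+2 / gamma alpha c N k w n.+1).
  by [].
have [P2q <-] := pair_eigen Hacn HP2 P1E (eps2 alpha c N n.+1) g0.
rewrite /D2 [in Nabla _]P2q linearZ /= -scalerAr hahn_Nabla //.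
by rewrite opprD addrA.
Qed.
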